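(* Let $A$ be an order partial combinatory algebra in the topos $\mathrm{Set}$ of sets, let $C$ be a combinatory complete filter of $A$, let $f$ be a partial interpretation of combinatory terms in $A$ with $f(\mathbf b),f(\mathbf c),f(\mathbf k),f(\mathbf w)\in C$, and let $U$ be any downset of $A$. Then the triposes $\mathrm{Cl}(\mathsf DA/C,U)$ and $\mathrm{CR}(\Pi_A,C,\perp\!\!\!\perp_U)$ over $\mathrm{Set}$ are equivalent.
   Context: Order partial applicative structure: a set $A$ with a preorder $\le$ and a partial binary operator $(x,y)\mapsto xy$ ($xy\downarrow$ means defined) such that $x\le x'$, $y\le y'$, $x'y'\downarrow$ imply $xy\downarrow$, $xy\le x'y'$. Application associates to the left. A filter is a subset $C$ that is upward closed and closed under (defined) application. Partial combinatory functions are the least class of partial functions $A^n\rightharpoonup A$ (all arities) containing projections and closed under pointwise application. $C$ is combinatory complete if for each partial combinatory $g:A^{n+1}\rightharpoonup A$ there is $r\in C$ with $r\vec x\downarrow$ for all $\vec x\in A^n$ and $r\vec y\downarrow$, $r\vec y\le g(\vec y)$ for all $\vec y\in\mathrm{dom}\,g$. An order partial combinatory algebra is an order partial applicative structure with a combinatory complete filter. A downset is a downward closed subset. Relative realizability side. $\mathsf DA/C$ is the fibration over $\mathrm{Set}$ whose objects over $X$ are families of downsets $Y\subseteq A\times X$ (downward closed in the $A$-coordinate, with fibres $Y_x$), with morphisms $(X,Y)\to(X',Y')$ the functions $h:X\to X'$ for which there is $t\in C$ such that for all $(a,x)\in Y$, $ta\downarrow$ and $(ta,h(x))\in Y'$.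 For downsets $V,W$ let $V\Rightarrow W=\{a\in A\mid\forall b\in V.\ ab\downarrow\wedge ab\in W\}$. A family $Y\subseteq A\times X$ is $U$-stable if there is $t\in C$ with $t\in((Y_x\Rightarrow U)\Rightarrow U)\Rightarrow Y_x$ for all $x\in X$. $\mathrm{Cl}(\mathsf DA/C,U)$ is the restriction of $\mathsf DA/C$ to the $U$-stable objects. Combinatory terms. The set $\mathrm{CT}$ of combinatory terms is generated from variables and constants $\mathbf b,\mathbf c,\mathbf k,\mathbf w$ by application. A partial interpretation is a partial function $f:\mathrm{CT}\rightharpoonup A$ such that $f(MN)\downarrow$ iff $f(M)f(N)\downarrow$, in which case $f(MN)=f(M)f(N)$, and such that for all $x,y,z\in A$: $f(\mathbf b)xy\downarrow$, and if $x(yz)\downarrow$ then $f(\mathbf b)xyz\downarrow$ and $f(\mathbf b)xyz\le x(yz)$; $f(\mathbf c)xy\downarrow$, and if $xzy\downarrow$ then $f(\mathbf c)xyz\downarrow$ and $f(\mathbf c)xyz\le xzy$; $f(\mathbf k)xy\downarrow$ and $f(\mathbf k)xy\le x$; $f(\mathbf w)x\downarrow$, and if $xyy\downarrow$ then $f(\mathbf w)xy\downarrow$ and $f(\mathbf w)xy\le xyy$. Let $\mathbf i=\mathbf{wk}$, $\mathbf g=\mathbf{ci}$, $\mathbf p=\mathbf{bcg}$. Classical realizability side. $\Pi_A$ is the stack structure induced by $A,C,f$: terms and stacks are both elements of $A$, push is $x\cdot y=f(\mathbf p)xy$, and term application is $x\bullet y=f(\mathbf b)x(f(\mathbf p)y)$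 (the structure further has continuations and a control constant, which do not enter the definition of the tripos below). The pole is $\perp\!\!\!\perp_U=\{(t,\pi)\in A\times A\mid t\pi\downarrow\wedge t\pi\in U\}$. For a set $S$ of stacks, $S^{\perp\!\!\!\perp}=\{t\in A\mid\forall\pi\in S.\ (t,\pi)\in\perp\!\!\!\perp_U\}$. $\mathrm{CR}(\Pi_A,C,\perp\!\!\!\perp_U)$ is the indexed preorder over $\mathrm{Set}$ (equivalently fibred category) whose fibre over $X$ is the set of functions $g:X\to\mathcal P(A)$, preordered by $g\Vdash_Xh$ iff there is $t\in C$ such that for all $x\in X$, $u\in g(x)^{\perp\!\!\!\perp}$ and $\pi\in h(x)$, $(t,u\cdot\pi)\in\perp\!\!\!\perp_U$; reindexing is composition. Equivalence means equivalence of fibred categories over $\mathrm{Set}$. *)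

(* Defs.v *)
From mathcomp Require Import all_boot.
From mathcomp Require Import boolp classical_sets.

Set Implicit Arguments.
Unset Strict Implicit.
Unset Printing Implicit Defensive.

Local Open Scope classical_set_scope.

Identity Coercion set_pred : set >-> Funclass.

(* A partial operation is an [option]-valued function. [dmem o W] says that
   [o] is defined and that its value belongs to [W]. *)
Definition dmem (T : Type) (o : option T) (W : set T) : Prop :=
  if o is Some a then W a else False.

Definition kapp (T : Type) (app : T -> T -> option T) (o o' : option T) :
    option T :=
  if o is Some a then if o' is Some b then app a b else None else None.

(* [ple le o o']: if [o'] is defined, then so is [o], and [o] lies below [o']. *)
Definition ple (T : Type) (le : T -> T -> Prop) (o o' : option T) : Prop :=
  if o' is Some c then dmem o [set a | le a c] else True.

Record opas := Opas {
  car :> Type;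
  ole : car -> car -> Prop;
  oapp : car -> car -> option car;
  ole_refl : forall x, ole x x;
  ole_trans : forall x y z, ole x y -> ole y z -> ole x z;
  oapp_mono : forall x x' y y',
    ole x x' -> ole y y' -> ple ole (oapp x y) (oapp x' y')
}.

Declare Scope opas_scope.
Delimit Scope opas_scope with opas.
Notation "x @ y" := (kapp (@oapp _) x y)
  (at level 40, left associativity) : opas_scope.
Notation "x <~ y" := (ple (@ole _) x y) (at level 70) : opas_scope.
Local Open Scope opas_scope.

Definition is_filter (A : opas) (C : set A) : Prop :=
  (forall x y, C x -> ole x y -> C y) /\
  (forall x y z, C x -> C y -> oapp x y = Some z -> C z).

Inductive partial_combinatory (A : opas) (n : nat) :
    (n.-tuple A -> option A) -> Prop :=
| pc_proj (i : 'I_n) : partial_combinatory (fun x => Some (tnth x i))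
| pc_app (g h : n.-tuple A -> option A) :
    partial_combinatory g -> partial_combinatory h ->
    partial_combinatory (fun x => g x @ h x).

Definition app_seq (A : opas) (r : A) (s : seq A) : option A :=
  foldl (fun o x => o @ Some x) (Some r) s.

Definition combinatory_complete (A : opas) (C : set A) : Prop :=
  forall (n : nat) (g : n.+1.-tuple A -> option A), partial_combinatory g ->
  exists r : A, [/\ C r,
    (forall x : n.-tuple A, isSome (app_seq r x)) &
    (forall y : n.+1.-tuple A, app_seq r y <~ g y)].

Record ccfilter (A : opas) := CCFilter {
  ccf_set :> set A;
  ccf_filter : is_filter ccf_set;
  ccf_complete : combinatory_complete ccf_set
}.

Record opca := Opca {
  opca_opas :> opas;
  opca_ccfilter : exists C : set opca_opas, is_filter C /\ combinatory_complete C
}.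

Record downset (A : opas) := Downset {
  dcar :> set A;
  downsetP : forall a b, ole a b -> dcar b -> dcar a
}.

(* A category over the category of sets ([Type] and functions), presented by its fibres of objects
   and by its sets of morphisms lying over a given function. Composition of
   functions is definitionally unital and associative, so that the laws
   require no transport. *)
Record cat_over := CatOver {
  ob : Type -> Type;
  hom : forall X X' : Type, (X -> X') -> ob X -> ob X' -> Type;
  idn : forall (X : Type) (Y : ob X), hom (fun x => x) Y Y;
  cmp : forall (X X' X'' : Type) (f : X -> X') (g : X' -> X'')
      (Y : ob X) (Y' : ob X') (Y'' : ob X''),
    hom f Y Y' -> hom g Y' Y'' -> hom (fun x => g (f x)) Y Y'';
  cmp_idl : forall (X X' : Type) (f : X -> X') (Y : ob X) (Y' : ob X')
    (u : hom f Y Y'), cmp (idn Y) u = u;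
  cmp_idr : forall (X X' : Type) (f : X -> X') (Y : ob X) (Y' : ob X')
    (u : hom f Y Y'), cmp u (idn Y') = u;
  cmpA : forall (X0 X1 X2 X3 : Type) (f : X0 -> X1) (g : X1 -> X2)
    (h : X2 -> X3) (Y0 : ob X0) (Y1 : ob X1) (Y2 : ob X2) (Y3 : ob X3)
    (u : hom f Y0 Y1) (v : hom g Y1 Y2) (w : hom h Y2 Y3),
    cmp (cmp u v) w = cmp u (cmp v w)
}.

Definition cartesian (E : cat_over) (X X' : Type) (f : X -> X')
    (Y : ob E X) (Y' : ob E X') (u : hom f Y Y') : Prop :=
  forall (W : Type) (g : W -> X) (Z : ob E W)
    (v : hom (fun w => f (g w)) Z Y'),
  exists! w : hom g Z Y, cmp w u = v.

Record fibration := Fibration {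
  fib_cat :> cat_over;
  fib_lift : forall (X X' : Type) (f : X -> X') (Y' : ob fib_cat X'),
    exists (Y : ob fib_cat X) (u : hom f Y Y'), cartesian u
}.

(* Functors over (the identity of) the base preserving cartesian morphisms. *)
Record fib_functor (E E' : cat_over) := FibFunctor {
  fob : forall X : Type, ob E X -> ob E' X;
  fmap : forall (X X' : Type) (f : X -> X') (Y : ob E X) (Y' : ob E X'),
    hom f Y Y' -> hom f (fob Y) (fob Y');
  fmap_id : forall (X : Type) (Y : ob E X), fmap (idn Y) = idn (fob Y);
  fmap_cmp : forall (X X' X'' : Type) (f : X -> X') (g : X' -> X'')
    (Y : ob E X) (Y' : ob E X') (Y'' : ob E X'')
    (u : hom f Y Y') (v : hom g Y' Y''), fmap (cmp u v) = cmp (fmap u) (fmap v);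
  fmap_cart : forall (X X' : Type) (f : X -> X') (Y : ob E X) (Y' : ob E X')
    (u : hom f Y Y'), cartesian u -> cartesian (fmap u)
}.

Definition fib_id (E : cat_over) : fib_functor E E.
Proof.
by refine (@FibFunctor E E (fun X Y => Y) (fun X X' f Y Y' u => u) _ _ _).
Defined.

(* [fib_comp F G] is [G] after [F]. *)
Definition fib_comp (E E' E'' : cat_over)
  (F : fib_functor E E') (G : fib_functor E' E'') : fib_functor E E''.
Proof.
refine (@FibFunctor E E'' (fun X Y => fob G (fob F Y))
  (fun X X' f Y Y' u => fmap G (fmap F u)) _ _ _).
- by move=> X Y; rewrite !fmap_id.
- by move=> *; rewrite !fmap_cmp.
- by move=> X X' f Y Y' u hu; do 2!apply: fmap_cart.
Defined.

(* Natural isomorphisms with components over identities. *)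
Definition vert_iso (E E' : cat_over) (F G : fib_functor E E') : Prop :=
  exists (alpha : forall (X : Type) (Y : ob E X),
            hom (fun x => x) (fob F Y) (fob G Y))
         (beta : forall (X : Type) (Y : ob E X),
            hom (fun x => x) (fob G Y) (fob F Y)),
  [/\ (forall (X X' : Type) (f : X -> X') (Y : ob E X) (Y' : ob E X')
         (u : hom f Y Y'),
         cmp (fmap F u) (alpha X' Y') = cmp (alpha X Y) (fmap G u)),
      (forall (X : Type) (Y : ob E X),
         cmp (alpha X Y) (beta X Y) = idn (fob F Y)) &
      (forall (X : Type) (Y : ob E X),
         cmp (beta X Y) (alpha X Y) = idn (fob G Y))].

Definition fib_equivalent (E E' : fibration) : Prop :=
  exists (F : fib_functor E E') (G : fib_functor E' E),
    vert_iso (fib_comp F G) (fib_id E) /\ vert_iso (fib_comp G F) (fib_id E').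

Definition full_subcat (E : cat_over) (P : forall X : Type, ob E X -> Prop) :
  cat_over.
Proof.
refine (@CatOver (fun X => {Y : ob E X | P X Y})
  (fun X X' f Y Y' => hom f (sval Y) (sval Y'))
  (fun X Y => idn (sval Y))
  (fun X X' X'' f g Y Y' Y'' u v => cmp u v) _ _ _).
- by move=> *; exact: cmp_idl.
- by move=> *; exact: cmp_idr.
- by move=> *; exact: cmpA.
Defined.

Definition full_subfib (E : fibration) (P : forall X : Type, ob E X -> Prop)
  (hP : forall (X X' : Type) (f : X -> X') (Y' : ob E X'), P X' Y' ->
     exists (Y : ob E X) (u : hom f Y Y'), P X Y /\ cartesian u) : fibration.
Proof.
refine (@Fibration (full_subcat P) _).
move=> X X' f [Y' PY']; have [Y [u [PY cu]]] := hP X X' f Y' PY'.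
exists (exist _ Y PY), u => W g [Z PZ] v; exact: cu.
Defined.

Record indexed_preorder := IndexedPreorder {
  ip_ob : Type -> Type;
  ip_le : forall X : Type, ip_ob X -> ip_ob X -> Prop;
  ip_re : forall X X' : Type, (X -> X') -> ip_ob X' -> ip_ob X;
  ip_refl : forall (X : Type) (g : ip_ob X), ip_le g g;
  ip_trans : forall (X : Type) (g h k : ip_ob X),
    ip_le g h -> ip_le h k -> ip_le g k;
  ip_re_mono : forall (X X' : Type) (f : X -> X') (g h : ip_ob X'),
    ip_le g h -> ip_le (ip_re f g) (ip_re f h);
  ip_re_id : forall (X : Type) (g : ip_ob X), ip_re (fun x => x) g = g;
  ip_re_comp : forall (X X' X'' : Type) (f : X -> X') (f' : X' -> X'')
    (g : ip_ob X''), ip_re (fun x => f' (f x)) g = ip_re f (ip_re f' g)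
}.

Definition grothendieck_cat (P : indexed_preorder) : cat_over.
Proof.
unshelve refine (@CatOver (ip_ob P)
  (fun X X' f g g' => ip_le g (ip_re f g')) _ _ _ _ _).
- by move=> X Y; have := ip_refl Y; rewrite -{2}[Y]ip_re_id.
- move=> X X' X'' f g Y Y' Y'' u v.
  have := ip_trans u (ip_re_mono f v); rewrite -ip_re_comp; exact.
- by move=> *; exact: Prop_irrelevance.
- by move=> *; exact: Prop_irrelevance.
- by move=> *; exact: Prop_irrelevance.
Defined.

Definition grothendieck (P : indexed_preorder) : fibration.
Proof.
refine (@Fibration (grothendieck_cat P) _).
move=> X X' f Y'; exists (ip_re f Y'), (ip_refl (ip_re f Y')).
move=> W g Z v /=.
have w : ip_le Z (ip_re g (ip_re f Y')) by rewrite -[X in ip_le _ X]ip_re_comp.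
by exists w; split=> *; exact: Prop_irrelevance.
Defined.

Lemma dmem_ple (A : opas) (o o' : option A) (W : set A) :
  (forall a b, ole a b -> W b -> W a) -> o <~ o' -> dmem o' W -> dmem o W.
Proof. by move=> dW; case: o o' => [a|] [b|] //=; apply: dW. Qed.

Lemma ple_trans (A : opas) (o1 o2 o3 : option A) :
  o1 <~ o2 -> o2 <~ o3 -> o1 <~ o3.
Proof. by case: o1 o2 o3 => [a|] [b|] [c|] //=; apply: ole_trans. Qed.

Lemma ple_refl (A : opas) (o : option A) : o <~ o.
Proof. by case: o => [a|] //=; apply: ole_refl. Qed.

Lemma ple_app (A : opas) (o1 o2 p1 p2 : option A) :
  o1 <~ o2 -> p1 <~ p2 -> o1 @ p1 <~ o2 @ p2.
Proof.
by case: o1 o2 p1 p2 => [a|] [b|] [c|] [d|] //=; [exact: oapp_mono|case: oapp..].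
Qed.

Lemma ccf_app (A : opas) (C : ccfilter A) (a b c : A) :
  C a -> C b -> oapp a b = Some c -> C c.
Proof. exact: (ccf_filter C).2. Qed.

Lemma ccf_id (A : opas) (C : ccfilter A) :
  exists2 i : A, C i & forall a, Some i @ Some a <~ Some a.
Proof.
have [r [Cr _ h]] := ccf_complete C (@pc_proj A 1 ord0).
by exists r => // a; have := h [tuple a].
Qed.

Lemma ccf_comp (A : opas) (C : ccfilter A) (t s : A) : C t -> C s ->
  exists2 r : A, C r &
    forall a, Some r @ Some a <~ Some s @ (Some t @ Some a).
Proof.
move=> Ct Cs.
have pc : partial_combinatory (fun x : 3.-tuple A =>
    Some (tnth x (@Ordinal 3 1 isT)) @
   (Some (tnth x (@Ordinal 3 0 isT)) @ Some (tnth x (@Ordinal 3 2 isT)))).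
  by do !constructor.
have [r [Cr hd h]] := ccf_complete C pc.
have := hd [tuple t; s]; rewrite /app_seq /=.
case e1 : (oapp r t) => [r1|] //=; case e2 : (oapp r1 s) => [r2|] //= _.
exists r2; first exact: ccf_app (ccf_app Cr Ct e1) Cs e2.
move=> a; have := h [tuple t; s; a].
by rewrite /app_seq /= e1 /= e2 /= !(tnth_nth a).
Qed.

Record da_family (A : opas) (X : Type) := DAFamily {
  da_set :> set (A * X);
  da_down : forall a b x, ole a b -> da_set (b, x) -> da_set (a, x)
}.

Definition fibre (A : opas) (X : Type) (Y : da_family A X) (x : X) : set A :=
  [set a | Y (a, x)].

Definition da_hom (A : opas) (C : ccfilter A) (X X' : Type) (h : X -> X')
    (Y : da_family A X) (Y' : da_family A X') : Prop :=
  exists2 t : A, C t & forall a x, Y (a, x) ->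
    dmem (Some t @ Some a) [set b | Y' (b, h x)].

(* The morphisms over [h] are the proofs of [da_hom C h Y Y']; by proof
   irrelevance, morphisms are thus just the functions [h] with a realizer. *)
Definition da_cat (A : opas) (C : ccfilter A) : cat_over.
Proof.
unshelve refine (@CatOver (da_family A) (@da_hom A C) _ _ _ _ _).
- move=> X Y; have [i Ci hi] := ccf_id C; exists i => // a x Yax.
  apply: dmem_ple (hi a) _ => //= b c; exact: da_down.
- move=> X X' X'' f g Y Y' Y'' [t Ct ht] [s Cs hs].
  have [r Cr hr] := ccf_comp Ct Cs; exists r => // a x Yax.
  apply: dmem_ple (hr a) _ => [b c /=|]; first exact: da_down.
  have := ht a x Yax; rewrite /=; case: (oapp t a) => [b|] //=; exact: hs.
- by move=> *; exact: Prop_irrelevance.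
- by move=> *; exact: Prop_irrelevance.
- by move=> *; exact: Prop_irrelevance.
Defined.

Definition da_reindex (A : opas) (X X' : Type) (f : X -> X')
  (Y : da_family A X') : da_family A X.
Proof.
refine (@DAFamily A X [set p | Y (p.1, f p.2)] _).
by move=> a b x /=; exact: da_down.
Defined.

Lemma da_reindex_cartesian (A : opas) (C : ccfilter A) (X X' : Type)
  (f : X -> X') (Y : da_family A X') :
  exists u : @hom (da_cat C) X X' f (da_reindex f Y) Y, cartesian u.
Proof.
have u : da_hom C f (da_reindex f Y) Y.
  have [i Ci hi] := ccf_id C; exists i => // a x Yax.
  apply: dmem_ple (hi a) _ => //= b c; exact: da_down.
exists u => W g Z v /=.
have w : da_hom C g Z (da_reindex f Y) by case: v => t Ct ht; exists t.
by exists w; split=> *; exact: Prop_irrelevance.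
Qed.

Definition DA (A : opas) (C : ccfilter A) : fibration.
Proof.
refine (@Fibration (da_cat C) _) => X X' f Y'.
by exists (da_reindex f Y'); exact: da_reindex_cartesian.
Defined.

Definition dimp (A : opas) (V W : set A) : set A :=
  [set a | forall b, V b -> dmem (Some a @ Some b) W].

Definition stable (A : opas) (C : ccfilter A) (U : downset A) (X : Type)
    (Y : da_family A X) : Prop :=
  exists2 t : A, C t &
    forall x, dimp (dimp (dimp (fibre Y x) U) U) (fibre Y x) t.

Lemma stable_reindex (A : opas) (C : ccfilter A) (U : downset A)
  (X X' : Type) (f : X -> X') (Y' : ob (DA C) X') : stable C U Y' ->
  exists (Y : ob (DA C) X) (u : hom f Y Y'), stable C U Y /\ cartesian u.
Proof.
move=> [t Ct ht]; have [u cu] := da_reindex_cartesian C f Y'.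
by exists (da_reindex f Y'), u; split=> //; exists t => // x; exact: (ht (f x)).
Qed.

Definition Cl (A : opas) (C : ccfilter A) (U : downset A) : fibration :=
  @full_subfib (DA C) (@stable A C U) (@stable_reindex A C U).

Inductive CT : Type :=
| tvar of nat
| tb | tc | tk | tw
| tapp of CT & CT.

(* In [itp_app], the equality of options says that [f(MN)] is defined exactly
   when [f(M)f(N)] is, and then has the same value. *)
Record interpretation (A : opas) := Interpretation {
  itp :> CT -> option A;
  itp_app : forall M N, itp (tapp M N) = itp M @ itp N;
  itp_b_def : forall x y, isSome (itp tb @ Some x @ Some y);
  itp_b : forall x y z,
    itp tb @ Some x @ Some y @ Some z <~ Some x @ (Some y @ Some z);
  itp_c_def : forall x y, isSome (itp tc @ Some x @ Some y);
  itp_c : forall x y z,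
    itp tc @ Some x @ Some y @ Some z <~ Some x @ Some z @ Some y;
  itp_k : forall x y, itp tk @ Some x @ Some y <~ Some x;
  itp_w_def : forall x, isSome (itp tw @ Some x);
  itp_w : forall x y, itp tw @ Some x @ Some y <~ Some x @ Some y @ Some y
}.

Definition ti := tapp tw tk.
Definition tg := tapp tc ti.
Definition tp := tapp (tapp tb tc) tg.

(* Terms and stacks are both elements of [A]; [push f x y] is the stack [x . y],
   always defined by [push_def]. *)
Definition push (A : opas) (f : interpretation A) (x y : A) : option A :=
  f tp @ Some x @ Some y.

Definition pole (A : opas) (U : downset A) : set (A * A) :=
  [set tpi | dmem (Some tpi.1 @ Some tpi.2) U].

Definition orth (A : opas) (U : downset A) (S : set A) : set A :=
  [set t | forall pi, S pi -> pole U (t, pi)].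

Definition cr_le (A : opas) (C : ccfilter A) (f : interpretation A)
    (U : downset A) (X : Type) (g h : X -> set A) : Prop :=
  exists2 t : A, C t & forall x u pi, orth U (g x) u -> h x pi ->
    dmem (push f u pi) [set s | pole U (t, s)].

Lemma def_app (A : opas) (o o' : option A) : isSome (o @ o') -> isSome o.
Proof. by case: o. Qed.

Lemma def_ple (A : opas) (o o' : option A) : o <~ o' -> isSome o' -> isSome o.
Proof. by case: o o' => [a|] [b|]. Qed.

Lemma itp_i (A : opas) (f : interpretation A) (x : A) :
  f ti @ Some x <~ Some x.
Proof.
rewrite itp_app.
have hk := itp_k f x x.
case ek : (f tk) hk => [k|] // hk.
exact: ple_trans (itp_w f k x) hk.
Qed.

Lemma itp_i_def (A : opas) (f : interpretation A) (x : A) : isSome (f ti).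
Proof. by have := itp_i f x; case: (f ti). Qed.

Lemma itp_g (A : opas) (f : interpretation A) (x y : A) :
  isSome (f tg @ Some x) /\ f tg @ Some x @ Some y <~ Some y @ Some x.
Proof.
rewrite itp_app; have := itp_i_def f x; case ei : (f ti) => [i|] // _.
split; first exact: itp_c_def.
apply: ple_trans (itp_c f i x y) _; apply: ple_app; last exact: ple_refl.
by rewrite -ei; exact: itp_i.
Qed.

Lemma push_le (A : opas) (f : interpretation A) (x y : A) :
  push f x y <~ f tc @ (f tg @ Some x) @ Some y /\
  isSome (f tc @ (f tg @ Some x) @ Some y).
Proof.
have [dg _] := itp_g f x x.
have gd := def_app dg; have cd := def_app (def_app (itp_c_def f x x)).
case eg : (f tg) gd dg => [g|] // _ dg.
case ec : (f tc) cd => [c|] // _.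
case egx : (Some g @ Some x) dg => [gx|] // _.
have dc : isSome (Some c @ Some gx @ Some y).
  by have := itp_c_def f gx y; rewrite ec.
split=> //; rewrite /push itp_app itp_app ec eg.
apply: ple_app; last exact: ple_refl.
by apply: ple_trans (itp_b f c g x) _; rewrite egx; exact: ple_refl.
Qed.

Lemma push_def (A : opas) (f : interpretation A) (x y : A) :
  isSome (push f x y).
Proof. by have [h d] := push_le f x y; exact: def_ple h d. Qed.

Lemma push_app (A : opas) (f : interpretation A) (x y z : A) :
  push f x y @ Some z <~ Some z @ Some x @ Some y.
Proof.
have [h _] := push_le f x y; have [dg hg] := itp_g f x z.
apply: ple_trans (ple_app h (ple_refl (Some z))) _.
case eg : (f tg @ Some x) dg hg => [gx|] // _ hg.
apply: ple_trans (itp_c f gx y z) _; apply: ple_app => //; exact: ple_refl.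
Qed.

Lemma cr_refl (A : opas) (C : ccfilter A) (f : interpretation A)
  (U : downset A) (X : Type) (g : X -> set A) : cr_le C f U g g.
Proof.
have pc : partial_combinatory (fun x : 2.-tuple A =>
    Some (tnth x (@Ordinal 2 1 isT)) @ Some (tnth x (@Ordinal 2 0 isT))).
  by do !constructor.
have [i Ci hi] := ccf_id C.
have [r [Cr hd h]] := ccf_complete C pc.
have := hd [tuple i]; rewrite /app_seq /=.
case e1 : (oapp r i) => [r1|] //= _.
exists r1; first exact: ccf_app Cr Ci e1.
move=> x u pi uo gpi; have := push_app f u pi i.
case: (push f u pi) (push_def f u pi) => [s|] // _ hs.
have hr := h [tuple i; s].
rewrite /app_seq /= e1 /= !(tnth_nth i) /= in hr.
have hU : dmem (Some i @ Some u @ Some pi) U.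
  apply: dmem_ple (ple_app (hi u) (ple_refl (Some pi))) _.
    by move=> a b; exact: downsetP.
  exact: uo.
apply: (dmem_ple _ hr); first by move=> a b; exact: downsetP.
by apply: (dmem_ple _ hs) hU => a b; exact: downsetP.
Qed.

Lemma cr_trans (A : opas) (C : ccfilter A) (f : interpretation A)
  (hb : dmem (f tb) C) (hc : dmem (f tc) C)
  (hk : dmem (f tk) C) (hw : dmem (f tw) C)
  (U : downset A) (X : Type) (g h k : X -> set A) :
  cr_le C f U g h -> cr_le C f U h k -> cr_le C f U g k.
Proof.
move=> [t Ct ht] [s Cs hs].
have hU a b : ole a b -> U b -> U a by exact: downsetP.
have Capp (o o' : option A) : dmem o C -> dmem o' C -> isSome (o @ o') ->
    dmem (o @ o') C.
  case: o o' => [a|] [b|] //= Ca Cb.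
  by case e : (oapp a b) => [c|] //= _; exact: ccf_app Ca Cb e.
have [p Cp ep] : exists2 p, C p & f tp = Some p.
  have dp : isSome (f tp) := def_app (def_app (push_def f t t)).
  have dg : isSome (f tg) := def_app (itp_g f t t).1.
  have di : isSome (f ti) := itp_i_def f t.
  have dbc : isSome (f (tapp tb tc)).
    by move: dp; rewrite /tp itp_app; exact: def_app.
  have : dmem (f tp) C.
    move: dp; rewrite /tp itp_app; apply: (Capp).
      by move: dbc; rewrite itp_app; exact: Capp.
    move: dg; rewrite /tg itp_app; apply: (Capp) => //.
    by move: di; rewrite /ti itp_app; exact: Capp.
  by case: (f tp) => [p|] //= Cp; exists p.
have pushE u pi : push f u pi = Some p @ Some u @ Some pi by rewrite /push ep.
(* q t p u rho <= t (p u rho) *)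
have [q [Cq dq hq]] : exists q, [/\ C q,
    forall a b c, isSome (Some q @ Some a @ Some b @ Some c) &
    forall a b c d, Some q @ Some a @ Some b @ Some c @ Some d <~
      Some a @ (Some b @ Some c @ Some d)].
  have pc : partial_combinatory (fun x : 4.-tuple A =>
      Some (tnth x (@Ordinal 4 0 isT)) @
      (Some (tnth x (@Ordinal 4 1 isT)) @ Some (tnth x (@Ordinal 4 2 isT)) @
       Some (tnth x (@Ordinal 4 3 isT)))) by do !constructor.
  have [r [Cr hd hr]] := ccf_complete C pc.
  exists r; split=> // [a b c|a b c d]; first exact: hd [tuple a; b; c].
  by have := hr [tuple a; b; c; d]; rewrite !(tnth_nth a).
(* e (q t p) s p u pi <= s (p (q t p u) pi) *)
have [e [Ce de he]] : exists e, [/\ C e,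
    forall a b c, isSome (Some e @ Some a @ Some b @ Some c) &
    forall a b c d d', Some e @ Some a @ Some b @ Some c @ Some d @ Some d' <~
      Some b @ (Some c @ (Some a @ Some d) @ Some d')].
  have pc : partial_combinatory (fun x : 5.-tuple A =>
      Some (tnth x (@Ordinal 5 1 isT)) @
      (Some (tnth x (@Ordinal 5 2 isT)) @
        (Some (tnth x (@Ordinal 5 0 isT)) @ Some (tnth x (@Ordinal 5 3 isT))) @
       Some (tnth x (@Ordinal 5 4 isT)))) by do !constructor.
  have [r [Cr hd hr]] := ccf_complete C pc.
  exists r; split=> // [a b c|a b c d d'].
    by have := hd [tuple a; b; c; a]; exact: def_app.
  by have := hr [tuple a; b; c; d; d']; rewrite !(tnth_nth a).
(* r m z <= z m *)
have [r [Cr dr hr]] : exists r, [/\ C r,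
    forall a, isSome (Some r @ Some a) &
    forall a b, Some r @ Some a @ Some b <~ Some b @ Some a].
  have pc : partial_combinatory (fun x : 2.-tuple A =>
      Some (tnth x (@Ordinal 2 1 isT)) @ Some (tnth x (@Ordinal 2 0 isT))).
    by do !constructor.
  have [r [Cr hd hr]] := ccf_complete C pc.
  exists r; split=> // [a|a b]; first exact: hd [tuple a].
  by have := hr [tuple a; b]; rewrite !(tnth_nth a).
have dqt : isSome (Some q @ Some t @ Some p) := def_app (dq t p t).
have Cqt : dmem (Some q @ Some t @ Some p) C.
  by apply: (Capp) => //; apply: (Capp) => //; exact: def_app dqt.
case eqt : (Some q @ Some t @ Some p) Cqt => [m|] // Cm.
have dem := de m s p.
have Cem : dmem (Some e @ Some m @ Some s @ Some p) C.
  apply: (Capp) => //; apply: (Capp) => //; last exact: def_app dem.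
  by apply: (Capp) => //; exact: def_app (def_app dem).
case eem : (Some e @ Some m @ Some s @ Some p) Cem => [n|] // Cn.
have Crn : dmem (Some r @ Some n) C by apply: (Capp) => //; exact: dr.
case ern : (Some r @ Some n) Crn => [l|] // Cl.
exists l => // x u pi uo kpi.
have := push_app f u pi n; have := push_def f u pi.
case: (push f u pi) => [z|] // _ hz /=.
have := hr n z; rewrite ern => hlz.
apply: (dmem_ple hU hlz); apply: (dmem_ple hU hz).
have := he m s p u pi; rewrite eem => hn; apply: (dmem_ple hU hn).
have := dq t p u; rewrite eqt; case emu : (Some m @ Some u) => [v|] // _.
have vo : orth U (h x) v.
  move=> rho hrho; rewrite /pole /=.
  have := hq t p u rho; rewrite eqt emu => hv; apply: (dmem_ple hU hv).
  have := ht x u rho uo hrho; rewrite pushE.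
  by case: (Some p @ Some u @ Some rho).
have := hs x v pi vo kpi; rewrite pushE.
by case: (Some p @ Some v @ Some pi).
Qed.

Definition CR_ip (A : opas) (C : ccfilter A) (f : interpretation A)
  (hb : dmem (f tb) C) (hc : dmem (f tc) C)
  (hk : dmem (f tk) C) (hw : dmem (f tw) C) (U : downset A) :
  indexed_preorder.
Proof.
refine (@IndexedPreorder (fun X => X -> set A) (@cr_le A C f U)
  (fun X X' h g => fun x => g (h x)) _ _ _ _ _).
- by move=> X g; exact: cr_refl.
- by move=> X g h k; exact: cr_trans.
- by move=> X X' h g g' [t Ct ht]; exists t => // x; exact: (ht (h x)).
- by [].
- by [].
Defined.

Definition CR (A : opas) (C : ccfilter A) (f : interpretation A)
    (hb : dmem (f tb) C) (hc : dmem (f tc) C)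
    (hk : dmem (f tk) C) (hw : dmem (f tw) C) (U : downset A) : fibration :=
  grothendieck (CR_ip hb hc hk hw U).

(* Main.v *)
(** The equivalence sends a family of downsets [Y] to the family of stack sets
  [Y_x => U], and a family of stack sets [g] to its orthogonal [g(x) => U],
  which is stable because a triple negation collapses to a single one. Both
  composites are double negation: on families of downsets it is isomorphic to
  the identity exactly by stability, and on stack sets it always is, since
  only orthogonals of stack sets matter on the left of [cr_le]. *)
From mathcomp Require Import all_boot.
From mathcomp Require Import boolp classical_sets.
Require Import Defs.

Set Implicit Arguments.
Unset Strict Implicit.
Unset Printing Implicit Defensive.

Local Open Scope classical_set_scope.
Local Open Scope opas_scope.

(** * Equivalences between fibrations with thin total categories *)

Definition thin (E : cat_over) : Prop :=
  forall (X X' : Type) (f : X -> X') (Y : ob E X) (Y' : ob E X')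
    (u v : hom f Y Y'), u = v.

Section ThinEquivalence.
Variables E E' : cat_over.
Hypotheses (thinE : thin E) (thinE' : thin E').
Variables (F : forall X, ob E X -> ob E' X) (G : forall X, ob E' X -> ob E X).
Hypothesis Fhom : forall (X X' : Type) (f : X -> X') (Y : ob E X)
  (Y' : ob E X'), hom f Y Y' -> hom f (F Y) (F Y').
Hypothesis Ghom : forall (X X' : Type) (f : X -> X') (Y : ob E' X)
  (Y' : ob E' X'), hom f Y Y' -> hom f (G Y) (G Y').
Hypothesis GF_id : forall X (Y : ob E X), hom (fun x => x) (G (F Y)) Y.
Hypothesis id_FG : forall X (Y : ob E' X), hom (fun x => x) Y (F (G Y)).

(* A morphism [v : Z -> F Y'] is transposed to [G Z -> G (F Y') -> Y'],
   factored through the cartesian [u], and transposed back. *)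
Lemma thin_cartesian (X X' : Type) (f : X -> X') (Y : ob E X) (Y' : ob E X')
  (u : hom f Y Y') : cartesian u -> cartesian (Fhom u).
Proof.
move=> cu W g Z v.
have [w _] := cu W g (G Z) (cmp (Ghom v) (GF_id Y')).
exists (cmp (id_FG Z) (Fhom w)); split; first exact: thinE'.
by move=> *; exact: thinE'.
Qed.

Definition thin_functor : fib_functor E E'.
Proof.
by exists F Fhom => [*|*|]; [exact: thinE'|exact: thinE'|exact: thin_cartesian].
Defined.

End ThinEquivalence.

(** Functoriality, naturality and inverse laws equate parallel morphisms, so thinness settles them;
    only the existence of comparison morphisms remains. *)
Lemma thin_equivalent (E E' : fibration) (thinE : thin E) (thinE' : thin E')
  (F : forall X, ob E X -> ob E' X) (G : forall X, ob E' X -> ob E X)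
  (Fhom : forall (X X' : Type) (f : X -> X') (Y : ob E X) (Y' : ob E X'),
    hom f Y Y' -> hom f (F X Y) (F X' Y'))
  (Ghom : forall (X X' : Type) (f : X -> X') (Y : ob E' X) (Y' : ob E' X'),
    hom f Y Y' -> hom f (G X Y) (G X' Y')) :
  (forall X (Y : ob E X), hom (fun x => x) (G X (F X Y)) Y) ->
  (forall X (Y : ob E X), hom (fun x => x) Y (G X (F X Y))) ->
  (forall X (Y : ob E' X), hom (fun x => x) (F X (G X Y)) Y) ->
  (forall X (Y : ob E' X), hom (fun x => x) Y (F X (G X Y))) ->
  fib_equivalent E E'.
Proof.
move=> GF_id id_GF FG_id id_FG.
exists (thin_functor thinE' Fhom Ghom GF_id id_FG).
exists (thin_functor thinE Ghom Fhom FG_id id_GF).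
split.
- by exists GF_id, id_GF; split=> *; exact: thinE.
- by exists FG_id, id_FG; split=> *; exact: thinE'.
Qed.

(** * Realizers from combinatory completeness *)

Definition representable (A : opas) (C : set A) (n : nat)
    (g : n.+1.-tuple A -> option A) : Prop :=
  exists r : A, [/\ C r,
    (forall x : n.-tuple A, isSome (app_seq r x)) &
    (forall y : n.+1.-tuple A, app_seq r y <~ g y)].

(** Partial combinatory functions have no constants; parameters from [C] enter by applying the
    representing element to them, which stays in [C]. *)
Lemma representable_spec (A : opas) (C : ccfilter A) (n : nat)
  (g : n.+2.-tuple A -> option A) (c : A) :
  C c -> representable C g -> representable C (fun y => g [tuple of c :: y]).
Proof.
move=> Cc [r [Cr dr hr]].
have rc : isSome (Some r @ Some c).
  (* The padding is arbitrary: an undefined [r c] would make every longer application undefined. *)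
  have := dr [tuple of c :: nseq n c]; rewrite /app_seq /=.
  by case: (oapp r c) => //; elim: (n).
case e : (Some r @ Some c) rc => [s|] // _.
exists s; split=> [|x|y]; first exact: ccf_app Cr Cc e.
- by have := dr [tuple of c :: x]; rewrite /app_seq -e.
- by have := hr [tuple of c :: y]; rewrite /app_seq -e.
Qed.

Section Realizers.
Variables (A : opas) (C : ccfilter A).

Lemma ccf_eval : exists r : A, [/\ C r,
    forall a, isSome (Some r @ Some a) &
    forall a b, Some r @ Some a @ Some b <~ Some b @ Some a].
Proof.
have pc : partial_combinatory (fun x : 2.-tuple A =>
    Some (tnth x (@Ordinal 2 1 isT)) @ Some (tnth x (@Ordinal 2 0 isT))).
  by do !constructor.
have [r [Cr dr hr]] := ccf_complete C pc.
exists r; split=> // [a|a b]; first exact: (dr [tuple a]).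
by have := hr [tuple a; b]; rewrite !(tnth_nth a).
Qed.

Lemma ccf_precomp (t : A) : C t -> exists d : A, [/\ C d,
    forall a, isSome (Some d @ Some a) &
    forall a b, Some d @ Some a @ Some b <~ Some a @ (Some t @ Some b)].
Proof.
move=> Ct; have pc : partial_combinatory (fun x : 3.-tuple A =>
    Some (tnth x (@Ordinal 3 1 isT)) @
    (Some (tnth x (@Ordinal 3 0 isT)) @ Some (tnth x (@Ordinal 3 2 isT)))).
  by do !constructor.
have [d [Cd dd hd]] := representable_spec Ct (ccf_complete C pc).
exists d; split=> // [a|a b]; first exact: (dd [tuple a]).
by have := hd [tuple a; b]; rewrite !(tnth_nth a).
Qed.

Lemma ccf_postcomp2 (p s : A) : C p -> C s -> exists d : A, [/\ C d,
    forall a, isSome (Some d @ Some a) &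
    forall a b, Some d @ Some a @ Some b <~
      Some s @ (Some p @ Some a @ Some b)].
Proof.
move=> Cp Cs; have pc : partial_combinatory (fun x : 4.-tuple A =>
    Some (tnth x (@Ordinal 4 1 isT)) @
    (Some (tnth x (@Ordinal 4 0 isT)) @ Some (tnth x (@Ordinal 4 2 isT)) @
     Some (tnth x (@Ordinal 4 3 isT)))) by do !constructor.
have [d [Cd dd hd]] :=
  representable_spec Cs (representable_spec Cp (ccf_complete C pc)).
exists d; split=> // [a|a b]; first exact: (dd [tuple a]).
by have := hd [tuple a; b]; rewrite !(tnth_nth a).
Qed.

End Realizers.

Lemma dmem_itp_app (A : opas) (C : ccfilter A) (f : interpretation A)
  (M N : CT) : dmem (f M) C -> dmem (f N) C -> isSome (f (tapp M N)) ->
  dmem (f (tapp M N)) C.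
Proof.
rewrite itp_app; case: (f M) (f N) => [a|] [b|] //= Ca Cb.
by case e : (oapp a b) => [c|] // _; exact: ccf_app Ca Cb e.
Qed.

(** * Negation [dimp _ U] and the passage between downsets and stacks *)

Section Fibres.
Variables (A : opas) (C : ccfilter A) (f : interpretation A).
Hypotheses (hb : dmem (f tb) C) (hc : dmem (f tc) C).
Hypotheses (hk : dmem (f tk) C) (hw : dmem (f tw) C).
Variable U : downset A.

Lemma itp_p : exists2 p, C p & f tp = Some p.
Proof.
(* Only an inhabitant is wanted, to which [push_def] and the like can be applied. *)
have [c Cc] : exists c, C c by case: (f tb) hb => // c; exists c.
have dp : isSome (f tp) := def_app (def_app (push_def f c c)).
have dbc : isSome (f (tapp tb tc)).
  by move: dp; rewrite /tp itp_app; exact: def_app.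
have : dmem (f tp) C.
  apply: dmem_itp_app => //; first exact: dmem_itp_app.
  apply: dmem_itp_app (def_app (itp_g f c c).1) => //.
  exact: dmem_itp_app (itp_i_def f c).
by case: (f tp) => // p Cp; exists p.
Qed.

Lemma dmemU (o o' : option A) : o <~ o' -> dmem o' U -> dmem o U.
Proof. by apply: dmem_ple => a b; exact: downsetP. Qed.

Lemma dimp_defined (V W : set A) (o : option A) : isSome o ->
  (forall b, V b -> dmem (o @ Some b) W) -> dmem o (dimp V W).
Proof. by case: o. Qed.

Lemma dimp_dni (V : set A) (r : A) :
  (forall a, isSome (Some r @ Some a)) ->
  (forall a b, Some r @ Some a @ Some b <~ Some b @ Some a) ->
  dimp V (dimp (dimp V U) U) r.
Proof.
move=> dr hr a Va; apply: dimp_defined => // b Vb.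
exact: dmemU (hr a b) (Vb a Va).
Qed.

Lemma dimp_contra (V W : set A) (t d : A) :
  (forall a, isSome (Some d @ Some a)) ->
  (forall a b, Some d @ Some a @ Some b <~ Some a @ (Some t @ Some b)) ->
  dimp V W t -> dimp (dimp W U) (dimp V U) d.
Proof.
move=> dd hd ht a Wa; apply: dimp_defined => // b Vb.
apply: dmemU (hd a b) _; have := ht b Vb.
by case: (Some t @ Some b) => // c; exact: Wa.
Qed.

(** A pushed stack feeds its two components to its argument. With the evaluator [r], [r e] applied
    to the stack of [u] and [pi] is below that stack applied to [e], hence below [e u pi]. *)
Lemma cr_le_curried (X : Type) (g h : X -> set A) :
  (exists2 e, C e & forall x u pi, orth U (g x) u -> h x pi ->
     dmem (Some e @ Some u @ Some pi) U) -> cr_le C f U g h.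
Proof.
move=> [e Ce he]; have [r [Cr dr hr]] := ccf_eval C.
have := dr e; case er : (Some r @ Some e) => [s|] // _.
exists s; first exact: ccf_app Cr Ce er.
move=> x u pi gu hpi; have := push_app f u pi e.
case: (push f u pi) (push_def f u pi) => // z _ hz.
apply: (@dmemU (Some s @ Some z) (Some z @ Some e)).
  by rewrite -er; exact: hr.
exact: dmemU hz (he x u pi gu hpi).
Qed.

(** As [orth U S] is convertible to [dimp S U], the orthogonal of these stacks is the double
    negation of the fibre. *)
Definition stacks (X : Type) (Y : da_family A X) : X -> set A :=
  fun x => dimp (fibre Y x) U.

Lemma orth_down (X : Type) (g : X -> set A) (a b : A) (x : X) :
  ole a b -> orth U (g x) b -> orth U (g x) a.
Proof.
move=> ab gb pi gpi; apply: dmemU (gb pi gpi).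
by apply: (@ple_app A (Some a) (Some b) (Some pi)) => //; exact: ple_refl.
Qed.

Definition orth_family (X : Type) (g : X -> set A) : da_family A X :=
  @DAFamily A X [set q | orth U (g q.2) q.1] (@orth_down X g).

(** The contrapositive of double negation introduction for [g x] reduces three negations to one,
    uniformly in [x]. *)
Lemma stable_orth (X : Type) (g : X -> set A) : stable C U (orth_family g).
Proof.
have [r [Cr dr hr]] := ccf_eval C.
have [d [Cd dd hd]] := ccf_precomp Cr.
exists d => // x.
change (dimp (dimp (dimp (dimp (g x) U) U) U) (dimp (g x) U) d).
exact: dimp_contra dd hd (dimp_dni dr hr).
Qed.

Lemma stacks_hom (X X' : Type) (h : X -> X') (Y : da_family A X)
  (Y' : da_family A X') :
  da_hom C h Y Y' -> cr_le C f U (stacks Y) (fun x => stacks Y' (h x)).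
Proof.
move=> [t Ct ht]; apply: cr_le_curried.
(* Contraposing [t] twice, by [d] and then [e], carries double negations of fibres to double
   negations. *)
have [d [Cd dd hd]] := ccf_precomp Ct.
have [e [Ce de he]] := ccf_precomp Cd.
exists e => // x u pi gu hpi.
have ht' : dimp (fibre Y x) (fibre Y' (h x)) t by move=> a; exact: ht.
have := dimp_contra de he (dimp_contra dd hd ht') gu.
by case: (Some e @ Some u) => // c; exact.
Qed.

Lemma orth_family_hom (X X' : Type) (h : X -> X') (g : X -> set A)
  (g' : X' -> set A) : cr_le C f U g (fun x => g' (h x)) ->
  da_hom C h (orth_family g) (orth_family g').
Proof.
move=> [s Cs hs]; have [p Cp ep] := itp_p.
(* Currying: [d a pi] lies below [s] applied to the push of [a] and [pi]. *)
have [d [Cd dd hd]] := ccf_postcomp2 Cp Cs.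
exists d => // a x ga.
apply: (@dimp_defined (g' (h x)) U) => // pi gpi.
apply: dmemU (hd a pi) _; have := hs x a pi ga gpi; rewrite /push ep.
by case: (Some p @ Some a @ Some pi).
Qed.

Lemma orth_stacks_le (X : Type) (Y : da_family A X) : stable C U Y ->
  da_hom C (fun x => x) (orth_family (stacks Y)) Y.
Proof. by move=> [t Ct ht]; exists t => // a x; exact: (ht x a). Qed.

Lemma le_orth_stacks (X : Type) (Y : da_family A X) :
  da_hom C (fun x => x) Y (orth_family (stacks Y)).
Proof.
have [r [Cr dr hr]] := ccf_eval C.
by exists r => // a x Ya; exact: (dimp_dni (V := fibre Y x) dr hr).
Qed.

Lemma stacks_orth_le (X : Type) (g : X -> set A) :
  cr_le C f U (stacks (orth_family g)) g.
Proof.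
apply: cr_le_curried; have [r [Cr dr hr]] := ccf_eval C.
have [d [Cd dd hd]] := ccf_precomp Cr.
exists d => // x u pi gu gpi.
(* Here [u] lies in the triple negation of [g x], so [d u] lies in its orthogonal. *)
have := dimp_contra dd hd (dimp_dni (V := g x) dr hr) gu.
by case: (Some d @ Some u) => // c; exact.
Qed.

Lemma le_stacks_orth (X : Type) (g : X -> set A) :
  cr_le C f U g (stacks (orth_family g)).
Proof.
apply: cr_le_curried; have [r [Cr _ hr]] := ccf_eval C.
(* The stack [pi] itself sends [u] into [U], so the evaluator just reverses the application. *)
by exists r => // x u pi gu hpi; exact: dmemU (hr u pi) (hpi u gu).
Qed.

End Fibres.

Theorem theorem3p3p19 (A : opca) (C : ccfilter A) (f : interpretation A)
  (hb : dmem (f tb) C) (hc : dmem (f tc) C)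
  (hk : dmem (f tk) C) (hw : dmem (f tw) C) (U : downset A) :
  fib_equivalent (Cl C U) (CR hb hc hk hw U).
Proof.
apply: (@thin_equivalent (Cl C U) (CR hb hc hk hw U) _ _
  (fun X Y => stacks U (sval Y))
  (fun X g => exist _ (orth_family U g) (stable_orth C U g))).
- move=> X X' h Y Y' u v.
  exact: (@Prop_irrelevance (da_hom C h (sval Y) (sval Y'))).
- move=> X X' h g g' u v.
  exact: (@Prop_irrelevance (cr_le C f U g (fun x => g' (h x)))).
- by move=> X X' h Y Y'; exact: stacks_hom.
- by move=> X X' h g g'; exact: orth_family_hom.
- by move=> X [Y sY]; exact: orth_stacks_le.
- by move=> X [Y sY]; exact: le_orth_stacks.
- by move=> X g; exact: stacks_orth_le.
- by move=> X g; exact: le_stacks_orth.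
Qed.
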